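(* Let $S$ be a set with a ternary operation $[\ ]$. Then $[\ ]$ is the natural ternary operation of an inverse semigroup on $S$ (i.e. there is a binary operation on $S$ making $S$ an inverse semigroup such that $[xyz]=(xy)z$ for all $x,y,z\in S$) if and only if $[\ ]$ is associative and there exist an involutive unary mapping ${}':x\mapsto x'$ on $S$ and an idempotent unary mapping ${}^\wedge:x\mapsto x^\wedge$ on $S$ such that the following identities hold for all $x,y,z\in S$: (1) $x=[x\,x'\,x]=[x\,x^\wedge\,x^\wedge]$; (2) $[x\,x^\wedge\,y]=[x\,y\,y^\wedge]$; (3) $x'=[x^\wedge\,x^\wedge\,x']$; (4) $x^\wedge=[x'\,x\,x^\wedge]=[x^\wedge\,x'\,x]$; (5) $\big[[x\,x^\wedge\,x']\,[y'\,y\,y^\wedge]\,[y'\,y\,y^\wedge]^\wedge\big]=\big[[y'\,y\,y^\wedge]\,[x\,x^\wedge\,x']\,[x\,x^\wedge\,x']^\wedge\big]$; (6) $[xyz]=\big[[x\,x^\wedge\,y]\,z\,z^\wedge\big]$.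
   Context: A ternary operation $[\ ]$ on $S$ is associative if $[[xyz]uv]=[x[yzu]v]=[xy[zuv]]$ for all $x,y,z,u,v\in S$. A unary mapping ${}'$ is involutive if $(x')'=x$ for all $x$; a unary mapping ${}^\wedge$ is idempotent if $(x^\wedge)^\wedge=x^\wedge$ for all $x$. *)

(* Defs.v *)
From mathcomp Require Import all_boot.

Set Implicit Arguments.
Unset Strict Implicit.
Unset Printing Implicit Defensive.

Definition ternary_associative (S : Type) (t : S -> S -> S -> S) : Prop :=
  forall x y z u v : S,
    t (t x y z) u v = t x (t y z u) v /\ t x (t y z u) v = t x y (t z u v).

(* The empty semigroup is allowed. *)
Definition inverse_semigroup (S : Type) (mul : S -> S -> S) : Prop :=
  associative mul /\
  forall x : S, exists! y : S,
    mul (mul x y) x = x /\ mul (mul y x) y = y.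

Definition natural_ternary (S : Type) (mul : S -> S -> S) (x y z : S) : S :=
  mul (mul x y) z.

(* Main.v *)
(* An inverse semigroup yields x' := x^-1 and x^ := x^-1 x, so that both [x x^ y]
   and [x y y^] are xy.  Conversely, by (2) the common value of these two brackets
   is a product, for which (6) gives associativity and (xy)z = [xyz]; (1) makes
   it regular, and (5) says that each xx' commutes with each y'y.  Every
   idempotent is of the form e'e, so idempotents commute and inverses are
   unique. *)

Require Import Defs.
From mathcomp Require Import all_boot.
From Stdlib Require Import IndefiniteDescription.

Set Implicit Arguments.
Unset Strict Implicit.
Unset Printing Implicit Defensive.

Section Semigroup.

Variables (S : Type) (mul : S -> S -> S).
Hypothesis mulA : associative mul.
Local Notation "x * y" := (mul x y).

Definition semigroup_inverse x y := x * y * x = x /\ y * x * y = y.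

(** Both [y] and [z] equal [y * x * z]: insert [x = x * z * x] into [y = y * x * y], or
    [x = x * y * x] into [z = z * x * z], and swap adjacent idempotents. *)
Lemma semigroup_inverse_unique :
  (forall e f, e * e = e -> f * f = f -> e * f = f * e) ->
  forall x y z, semigroup_inverse x y -> semigroup_inverse x z -> y = z.
Proof.
move=> idC x y z [xyx yxy] [xzx zxz].
have xyC : x * y * (x * z) = x * z * (x * y).
  by apply: idC; rewrite mulA ?xyx ?xzx.
have yxC : z * x * (y * x) = y * x * (z * x).
  by apply: idC; rewrite mulA ?yxy ?zxz.
have -> : y = y * x * z.
  by rewrite -{1}yxy -mulA -{1}xzx -(mulA (x * z)) -xyC !mulA yxy.
by rewrite -[RHS]zxz -{2}xyx !mulA -(mulA (z * x)) yxC -!mulA (mulA z) zxz.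
Qed.

Lemma inverse_semigroup_idempotentsC :
  inverse_semigroup mul ->
  forall e f, e * e = e -> f * f = f -> e * f = f * e.
Proof.
move=> [_ invE].
have inv_uniq x y z : semigroup_inverse x y -> semigroup_inverse x z -> y = z.
  by case: (invE x) => w [_ w_uniq] /w_uniq <- /w_uniq <-.
have idM e f : e * e = e -> f * f = f -> e * f * (e * f) = e * f.
  move=> ee ff; have [z [[efz zef] _]] := invE (e * f).
  (* With z inverse to ef, g = fze is idempotent and inverse to ef, so g and ef
     are both inverse to g. *)
  set g := f * z * e.
  have fg : f * g = g by rewrite /g !mulA ff.
  have ge : g * e = g by rewrite /g -!mulA ee.
  have gg : g * g = g by rewrite /g -{3}zef !mulA.
  have efg : e * f * g * (e * f) = e * f.
    by rewrite -[RHS]efz /g !mulA -(mulA e f f) ff -(mulA _ e e) ee.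
  have gef : g * (e * f) * g = g by rewrite mulA ge -(mulA g f) fg gg.
  by rewrite (inv_uniq g (e * f) g) //; split; rewrite // gg.
(* By [idM], [e * f] is idempotent and hence its own inverse; [f * e] is an inverse of it as
   well. *)
move=> e f ee ff; apply: (inv_uniq (e * f)).
  by split; rewrite !idM.
split.
  by rewrite !mulA -(mulA e f f) ff -(mulA _ e e) ee -mulA idM.
by rewrite !mulA -(mulA f e e) ee -(mulA _ f f) ff -mulA idM.
Qed.

Lemma regular_idempotentsC (inv : S -> S) :
  involutive inv -> (forall x, x * inv x * x = x) ->
  (forall x y, x * inv x * (inv y * y) = inv y * y * (x * inv x)) ->
  forall e f, e * e = e -> f * f = f -> e * f = f * e.
Proof.
move=> invK xVx VC.
have VxV x : inv x * x * inv x = inv x by rewrite -{2}[x]invK xVx.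
have id_form e : e * e = e -> e = inv e * e.
  move=> ee.
  (* As [e] is idempotent, [inv e * e * (e * inv e)] collapses to [inv e]. Swapping the two factors
     shows that [inv e] starts and ends with [e], so it absorbs [e] on either side. *)
  have eV : inv e = e * inv e * (inv e * e).
    by rewrite VC mulA -(mulA _ e e) ee VxV.
  have Ve : inv e * e = inv e by rewrite {1}eV -mulA -(mulA _ e e) ee -eV.
  have eVe : e * inv e = inv e by rewrite {1}eV !mulA ee -mulA -eV.
  by rewrite -{1}(xVx e) eVe.
move=> e f /id_form -> /id_form ->.
(* Reading [e] as [inv (inv e)] gives [inv e * e] the shape [x * inv x] with [x := inv e]. *)
by rewrite -{2 4}[e]invK VC.
Qed.

End Semigroup.

Lemma inverse_semigroup_inv (S : Type) (mul : S -> S -> S) :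
  inverse_semigroup mul ->
  exists2 inv : S -> S, involutive inv &
    (forall x, semigroup_inverse mul x (inv x)) /\
    (forall x y, semigroup_inverse mul x y -> inv x = y).
Proof.
move=> [_ /functional_choice [inv invP]].
exists inv; last by split=> x; case: (invP x).
(* Being inverse is symmetric, so [x] is the unique inverse of [inv x]. *)
by move=> x; apply: (invP (inv x)).2; case: (invP x) => -[].
Qed.

Theorem theorem92 (S : Type) (t : S -> S -> S -> S) :
  (exists mul : S -> S -> S,
     inverse_semigroup mul /\
     forall x y z : S, t x y z = natural_ternary mul x y z)
  <->
  (ternary_associative t /\
   exists (inv hat : S -> S),
     involutive inv /\ idempotent_fun hat /\
     (forall x : S, x = t x (inv x) x /\ x = t x (hat x) (hat x)) /\
     (forall x y : S, t x (hat x) y = t x y (hat y)) /\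
     (forall x : S, inv x = t (hat x) (hat x) (inv x)) /\
     (forall x : S, hat x = t (inv x) x (hat x) /\
                    hat x = t (hat x) (inv x) x) /\
     (forall x y : S,
        t (t x (hat x) (inv x))
          (t (inv y) y (hat y))
          (hat (t (inv y) y (hat y)))
        = t (t (inv y) y (hat y))
            (t x (hat x) (inv x))
            (hat (t x (hat x) (inv x)))) /\
     (forall x y z : S, t x y z = t (t x (hat x) y) z (hat z))).
Proof.
split=> [[mul [mulS tE]] | [tA [inv [hat [invK [_ [t1 [t2 [_ [_ [t5 t6]]]]]]]]]]].
  have mulA := mulS.1.
  have [inv invK [invP inv_uniq]] := inverse_semigroup_inv mulS.
  have idC := inverse_semigroup_idempotentsC mulA mulS.
  have xVx x : mul (mul x (inv x)) x = x := (invP x).1.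
  have VxV x : mul (mul (inv x) x) (inv x) = inv x := (invP x).2.
  have id_inv e : mul e e = e -> inv e = e.
    by move=> ee; apply: inv_uniq; split; rewrite !ee.
  have idVx x : mul (mul (inv x) x) (mul (inv x) x) = mul (inv x) x.
    by rewrite mulA VxV.
  have idxV x : mul (mul x (inv x)) (mul x (inv x)) = mul x (inv x).
    by rewrite mulA xVx.
  pose hat x := mul (inv x) x.
  have xhat x : mul x (hat x) = x by rewrite mulA xVx.
  have hat_id e : mul e e = e -> hat e = e by move=> ee; rewrite /hat id_inv.
  have hatV x : mul (hat x) (inv x) = inv x := VxV x.
  split.
    by move=> x y z u v; rewrite !tE /natural_ternary !mulA.
  exists inv, hat; do !split=> //.
  - by move=> x; apply: hat_id (idVx x).
  - by rewrite tE /natural_ternary xVx.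
  - by rewrite tE /natural_ternary !xhat.
  - by move=> x y; rewrite !tE /natural_ternary xhat -mulA xhat.
  - by move=> x; rewrite tE /natural_ternary -mulA !hatV.
  - by rewrite tE /natural_ternary idVx.
  - by rewrite tE /natural_ternary hatV.
  (* Since [hat u] is a right unit for [u], identity (5) shrinks to [e * f = f * e] for two
     idempotents. *)
  - move=> x y; rewrite !tE /natural_ternary -(mulA _ y) !xhat.
    set e := mul x _; set f := mul _ y.
    rewrite -(mulA e f) -(mulA f e) !xhat.
    exact: idC (idxV x) (idVx y).
  - by move=> x y z; rewrite !tE /natural_ternary xhat -(mulA _ z) xhat.
pose mul x y := t x (hat x) y.
have mulE x y : mul x y = t x y (hat y) by apply: t2.
have mul_t x y z : mul (mul x y) z = t x y z by rewrite mulE [RHS]t6.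
have mulA : associative mul.
  (* Both sides become bracketings of the word [x, hat x, y, z, hat z], which [tA] identifies. *)
  move=> x y z; rewrite mul_t t6 {1}/mul mulE.
  by have [-> ->] := tA x (hat x) y z (hat z).
have xVx x : mul (mul x (inv x)) x = x by rewrite mul_t -(t1 x).1.
have VC x y : mul (mul x (inv x)) (mul (inv y) y)
            = mul (mul (inv y) y) (mul x (inv x)).
  (* Read backwards, [t2] turns every [t u v (hat v)] in (5) into [mul u v]. *)
  by have := t5 x y; rewrite -!t2 -/(mul x _) -/(mul _ y).
have idC := regular_idempotentsC mulA invK xVx VC.
exists mul; split; last by move=> x y z; rewrite -mul_t.
split=> // x; exists (inv x).
have invP : semigroup_inverse mul x (inv x).
  by split; rewrite // -{2}[x]invK xVx.
by split=> // y; apply: semigroup_inverse_unique.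
Qed.
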